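(* Let $K$ be a compact line. For $x\le y$ in $K$ put $x\sim y$ (and $y\sim x$) if the interval $[x,y]$ is connected; this is an equivalence relation on $K$. Let $$K_0=K\setminus\bigcup\{(a,b) : a,b\in K,\ a<b,\ a\sim b\}.$$ Then $K$ is Valdivia compact if and only if the following conditions are satisfied: (1) each equivalence class of $\sim$ is a Valdivia compact space; (2) the space $K_0$ is Valdivia compact; (3) each point of $K$ of uncountable character is isolated from one side.
   Context: A compact line is a compact space together with a linear order which induces its topology. A compact space $K$ is Valdivia (compact) if there are a set $\Gamma$ and a homeomorphism of $K$ onto some $K'\subseteq\mathbb{R}^\Gamma$ such that $\{x\in K' : \{\gamma\in\Gamma : x(\gamma)\neq 0\}\text{ is countable}\}$ is dense in $K'$. A point $x\in K$ has uncountable character if it has no countable neighborhood base in $K$. A point $x\in K$ is isolated from one side if one of the intervals $(\leftarrow,x]$ or $[x,\to)$ is open in $K$. Equivalence classes of $\sim$ and $K_0$ carry the subspace topology from $K$. *)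

(* Defs.v *)
From HB Require Import structures.
From mathcomp Require Import all_boot all_order all_algebra.
From mathcomp Require Import all_classical all_reals all_analysis.
Import Order.TTheory GRing.Theory Num.Theory.
Import numFieldNormedType.Exports.

Set Implicit Arguments.
Unset Strict Implicit.
Unset Printing Implicit Defensive.

Local Open Scope classical_set_scope.
Local Open Scope ring_scope.

Definition homeomorphic (X Y : topologicalType) : Prop :=
  exists (f : X -> Y) (g : Y -> X),
    [/\ cancel f g, cancel g f, continuous f & continuous g].

(* A set [A] used as a type is [set_type A], whose library topology is the one
   induced by the inclusion; density is hence relative to [K'].  No separation
   axiom is required: it follows from the embedding into [R^Gamma]. *)
Definition valdivia_compact (R : realType) (X : topologicalType) : Prop :=
  compact [set: X] /\
  exists (Gamma : Type) (K' : set {ptws Gamma -> R}),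
    homeomorphic X K' /\
    dense [set x : K' | countable [set gamma | set_val x gamma != 0]].

Section compact_line.
Context {d : Order.disp_t} {K : orderTopologicalType d}.
Implicit Types x y : K.

Definition line_sim x y : Prop :=
  ((x <= y)%O /\ connected `[x, y]%classic) \/ ((y <= x)%O /\ connected `[y, x]%classic).

Definition line_class x : set K := [set y | line_sim x y].

Definition line_K0 : set K :=
  [set: K] `\`
    \bigcup_(ab in [set ab : K * K | (ab.1 < ab.2)%O /\ line_sim ab.1 ab.2])
      `]ab.1, ab.2[%classic.

Definition uncountable_character x : Prop :=
  ~ exists B : set (set K),
      [/\ countable B, B `<=` nbhs x &
          forall U, nbhs x U -> exists2 V, B V & V `<=` U].

Definition isolated_from_one_side x : Prop :=
  open `]-oo, x]%classic \/ open `[x, +oo[%classic.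

Lemma connected_subitv (a b x y : K) : (a <= x)%O -> (x <= y)%O -> (y <= b)%O ->
  connected `[a, b]%classic -> connected `[x, y]%classic.
Proof.
move=> ax xy yb cab.
pose f z := Order.max x (Order.min y z).
have -> : [set` `[x, y]] = f @` `[a, b]%classic.
  apply/seteqP; split => z /=; rewrite in_itv /=.
    move=> /andP[xz zy]; exists z; last by rewrite /f (min_r zy) (max_r xz).
    by rewrite /= in_itv /= (le_trans ax xz) (le_trans zy yb).
  move=> [w _ <-]; rewrite /f le_max lexx /= ge_max xy /=.
  by rewrite ge_min lexx.
apply: connected_continuous_connected => //.
apply: continuous_subspaceT.
have cst (c : K) : continuous (fun _ : K => c) by move=> ?; exact: cvg_cst.
apply: (max_fun_continuous (cst x)).
by apply: (min_fun_continuous (cst y)) => z; exact: cvg_id.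
Qed.

Lemma line_sim_equivalence : RelationClasses.Equivalence line_sim.
Proof.
have symm x y : line_sim x y -> line_sim y x by case; [right|left].
split=> //.
  by move=> x; left; split=> //; rewrite set_itv1; exact: connected1.
have sub x y z : (x <= y)%O -> (y <= z)%O -> line_sim x z ->
    line_sim x y /\ line_sim y z.
  move=> xy yz; have xz := le_trans xy yz.
  have : line_sim x z -> connected `[x, z]%classic.
    case=> -[] // zx; have -> // : x = z by apply/eqP; rewrite eq_le xz.
  move=> /[apply] c; split; left; split => //.
    exact: (connected_subitv _ _ _ c).
  exact: (connected_subitv _ _ _ c).
have cat x y z : (x <= y)%O -> (y <= z)%O -> line_sim x y -> line_sim y z ->
    line_sim x z.
  have conn u v : (u <= v)%O -> line_sim u v -> connected `[u, v]%classic.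
    move=> uv [[]//|[vu]].
    by have -> // : u = v by apply/eqP; rewrite eq_le uv.
  move=> xy yz /(conn _ _ xy) cxy /(conn _ _ yz) cyz.
  left; split; first exact: le_trans yz.
  have -> : [set` `[x, z]] = `[x, y]%classic `|` `[y, z]%classic.
    apply/seteqP; split => w /=; rewrite !in_itv /=.
      move=> /andP[xw wz]; rewrite xw wz andbT; exact/orP/le_total.
    by case=> /andP[p q]; rewrite ?(le_trans xy p) ?(le_trans q yz) ?p ?q.
  apply: connectedU => //; exists y.
  by split; rewrite /= in_itv /= lexx ?xy ?yz.
move=> x y z xy yz.
have [le1|/ltW le1] := leP x y; have [le2|/ltW le2] := leP y z.
- exact: (cat x y z).
- have [le3|/ltW le3] := leP x z.
    by have [] := sub x z y le3 le2 xy.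
  by have [zx _] := sub z x y le3 le1 (symm _ _ yz); exact: symm.
- have [le3|/ltW le3] := leP x z.
    by have [] := sub y x z le1 le3 yz.
  by have [_ zx] := sub y z x le2 le3 (symm _ _ xy); exact: symm.
- by apply: (symm z x); apply: (cat z y x) => //; exact: symm.
Qed.

End compact_line.

(* Main.v *)
(* For a family of real coordinates, call a point good if only countably many
   coordinates are nonzero at it.  K is Valdivia compact iff some separating
   family of continuous coordinates has a dense set of good points, and then
   every point of countable character is good.

   If K is Valdivia and x is a limit of points from both sides, a closing-off
   argument produces countably many good points on either side of x whose
   cluster points have the same coordinates, hence equal x: so x has countable
   character, which is (3), and x is good.  Good points are dense in the
   interior of a nontrivial class, so coordinates restrict to classes; on K0
   they are first composed with a map pushing those endpoints of classes that
   are isolated in K from the outer side to good points inside the class.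

   Conversely, the coordinates of K0 are interpolated through each class [a, b],
   and the coordinates of [a, b] are multiplied by functions which vanish off
   [a, b] and have no common zero in (a, b).  By (3) each endpoint has countable
   character or is isolated from the outer side, so such functions exist and
   the endpoints are good for K0. *)

Require Import Defs.
From HB Require Import structures.
From mathcomp Require Import all_boot all_order all_algebra.
From mathcomp Require Import ring lra.
From mathcomp Require Import all_classical all_reals all_analysis.
Import numFieldNormedType.Exports.

Set Implicit Arguments.
Unset Strict Implicit.
Unset Printing Implicit Defensive.

Import Order.TTheory GRing.Theory Num.Theory.

Local Open Scope classical_set_scope.
Local Open Scope ring_scope.

(** * Valdivia compacta through separating coordinates *)

Lemma proj_ptws_continuous (Y : topologicalType) (Gamma : Type) (g : Gamma) :
  continuous (fun u : {ptws Gamma -> Y} => u g).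
Proof.
move=> u A nA.
have /cvg_sup/(_ g) : nbhs u --> (u : {ptws Gamma -> Y}) by exact: cvg_id.
apply; exact: (@initial_continuous _ _ (fun v : {ptws Gamma -> Y} => v g)).
Qed.

Lemma ptws_continuous (X Y : topologicalType) (Gamma : Type)
    (f : X -> {ptws Gamma -> Y}) :
  (forall g, continuous (fun x => f x g)) -> continuous f.
Proof.
move=> cf x; apply/cvg_sup => g A /= [_ [[B oB <-] Bfx sBA]].
apply: (filterS sBA); apply: (cf g x).
by apply: open_nbhs_nbhs; split.
Qed.

Lemma ptws_hausdorff (Y : topologicalType) (Gamma : Type) :
  hausdorff_space Y -> hausdorff_space {ptws Gamma -> Y}.
Proof.
move=> hY u v uv; apply/funext => g; apply: hY => A B nA nB.
have [w [wA wB]] := uv _ _ (proj_ptws_continuous (g := g) nA)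
  (proj_ptws_continuous (g := g) nB).
by exists (w g).
Qed.

Lemma set_type_continuous (X Y : topologicalType) (A : set Y) (f : X -> A) :
  continuous (set_val \o f) -> continuous f.
Proof.
move=> cf x U /= [_ [[B oB <-] Bfx sBU]].
apply: (filterS sBU); apply: (cf x).
by apply: open_nbhs_nbhs; split.
Qed.

Lemma compact_inj_inverse (X Y : topologicalType) (f : X -> Y) (g : Y -> X) :
  compact [set: X] -> hausdorff_space Y -> cancel f g -> cancel g f ->
  continuous f -> continuous g.
Proof.
move=> cX hY fK gK cf; apply/continuous_closedP => C clC.
have -> : g @^-1` C = f @` C.
  apply/seteqP; split=> [y Cy|_ [x Cx <-]] /=; last by rewrite fK.
  by exists (g y).
apply: compact_closed => //; apply: continuous_compact.
  exact: continuous_subspaceT.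
exact: subclosed_compact cX _.
Qed.

(** The coordinates are total on [X] but constrained only on [A], so subspaces of [K] are treated
    without passing to subtypes. The last clause is density in [A] of the good points. *)
Definition sigma_coordinates (R : realType) (X : topologicalType) (A : set X)
    (Gamma : Type) (f : Gamma -> X -> R) : Prop :=
  [/\ forall g, {within A, continuous (f g)},
      forall x y, A x -> A y -> (forall g, f g x = f g y) -> x = y &
      forall U, open U -> U `&` A !=set0 ->
        exists x, [/\ U x, A x & countable [set g | f g x != 0]]].

Lemma valL_set_val (X : Type) (V : Type) (v : V) (A : set X) (f : A -> V)
  (x : A) : valL_ v f (set_val x) = f x.
Proof. by rewrite -[RHS](congr1 (fun h => h x) (valLK v f)). Qed.

(** The coordinates of an embedding into R^Gamma, extended by 0 off [A]. *)
Lemma valdivia_coordinates (R : realType) (X : topologicalType) (A : set X) :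
  valdivia_compact R A -> exists (Gamma : Type) (f : Gamma -> X -> R),
    sigma_coordinates A f.
Proof.
move=> [cA [Gamma [K' [[f [g [fK gK cf cg]]] dK]]]].
pose F gam : A -> R := fun x => set_val (f x) gam.
exists Gamma, (fun gam => valL_ 0 (F gam)); split.
- move=> gam; apply/subspace_valL_continuousP' => x.
  apply: (@continuous_comp _ _ _ (set_val \o f)
    (fun u : {ptws Gamma -> R} => u gam)).
    apply: (@continuous_comp _ _ _ f set_val); first exact: cf.
    exact: initial_continuous.
  exact: proj_ptws_continuous.
- move=> x y Ax Ay.
  pose x' : A := exist _ x (mem_set Ax); pose y' : A := exist _ y (mem_set Ay).
  move=> E; suff : x' = y' by move=> /(congr1 val).
  apply: (can_inj fK); apply: val_inj; apply/funext => gam.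
  rewrite -[LHS](valL_set_val 0 (F gam) x') -[RHS](valL_set_val 0 (F gam) y').
  by rewrite set_valE; exact: E.
- move=> U oU [x [Ux Ax]]; pose x' : A := exist _ x (mem_set Ax).
  have [||y [Uy cy]] := dK (g @^-1` (set_val @^-1` U)).
  + by exists (f x'); rewrite /= fK /= set_valE.
  + apply: open_comp; first by move=> z _; exact: cg.
    by apply: open_comp => // z _; exact: initial_continuous.
  exists (set_val (g y)); split => //; first exact: set_valP.
  by move: cy; congr (countable _); apply/eq_set => gam; rewrite valL_set_val /F gK.
Qed.

(** Evaluation at all coordinates is a continuous injection of a compact space into the Hausdorff
    space R^Gamma, hence a homeomorphism onto its range. *)
Lemma coordinates_valdivia (R : realType) (X : topologicalType) (A : set X)
    (Gamma : Type) (f : Gamma -> X -> R) :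
  compact A -> sigma_coordinates A f -> valdivia_compact R A.
Proof.
move=> cA [cf injf df].
have cAT : compact [set: A].
  move=> F FF _.
  have [|x [Ax clx]] := cA (set_val @ F) _.
    by apply: (@filterS _ F _ setT) => [x _|]; [exact: set_valP|exact: filterT].
  exists (exist _ x (mem_set Ax)); split => // B V FB [_ [[W oW <-] Wx sWV]].
  have [||z [[y By <-] Wz]] := clx (set_val @` B) W.
  + by apply: (@filterS _ F _ B _ _ FB) => y By; exists y.
  + by apply: open_nbhs_nbhs; split.
  by exists y; split => //; exact: sWV.
split => //.
pose e : A -> {ptws Gamma -> R} := fun x gam => f gam (set_val x).
have ce : continuous e.
  by apply: ptws_continuous => gam; exact/subspace_sigL_continuousP/cf.
pose K' : set {ptws Gamma -> R} := range e.
have eK' x : e x \in K' by apply/mem_set; exists x.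
pose e' x : K' := exist _ (e x) (eK' x).
have e'P (y : K') : exists x, e x = set_val y.
  by have [x _ xy] := set_valP y; exists x.
pose h y := projT1 (cid (e'P y)).
have hP y : e (h y) = set_val y := projT2 (cid (e'P y)).
have inje x y : e x = e y -> x = y.
  move=> exy; apply: val_inj.
  apply: injf => [||gam]; [exact: set_valP|exact: set_valP|].
  by have := congr1 (fun u => u gam) exy; rewrite /e set_valE.
have hK : cancel h e' by move=> y; apply: val_inj; have := hP y; rewrite set_valE.
have eK : cancel e' h by move=> x; apply: inje; rewrite hP.
have ce' : continuous e' by apply: set_type_continuous.
have ch : continuous h.
  apply: (compact_inj_inverse cAT _ eK hK ce').
  have HH := ptws_hausdorff (Gamma := Gamma) (@Rhausdorff R).
  move=> u v uv; apply: val_inj; apply: HH => B C nB nC.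
  have [||w [wB wC]] := uv (set_val @^-1` B) (set_val @^-1` C).
  + exact: initial_continuous.
  + exact: initial_continuous.
  by exists (set_val w).
exists Gamma, K'; split; first by exists e', h.
move=> O [y Oy] oO.
have [V oV eV] : open (e' @^-1` O) by apply: open_comp => // z _; exact: ce'.
have [|x [Vx Ax cx]] := df V oV.
  exists (set_val (h y)); split; last exact: set_valP.
  by rewrite -[V _]/((set_val @^-1` V) (h y)) eV /= hK.
exists (e' (exist _ x (mem_set Ax))); split => //.
by change ((e' @^-1` O) (exist _ x (mem_set Ax))); rewrite -eV.
Qed.

(** * Invariance under homeomorphism, and points of countable character *)

Lemma homeomorphic_sym (X Y : topologicalType) :
  homeomorphic X Y -> homeomorphic Y X.
Proof. by move=> [f [g [fK gK cf cg]]]; exists g, f. Qed.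

Lemma homeomorphic_trans (X Y Z : topologicalType) :
  homeomorphic X Y -> homeomorphic Y Z -> homeomorphic X Z.
Proof.
move=> [f [g [fK gK cf cg]]] [f' [g' [f'K g'K cf' cg']]].
exists (f' \o f), (g \o g'); split.
- by move=> x /=; rewrite f'K.
- by move=> x /=; rewrite gK.
- by move=> x; apply: continuous_comp; [exact: cf|exact: cf'].
- by move=> x; apply: continuous_comp; [exact: cg'|exact: cg].
Qed.

Lemma homeomorphic_valdivia (R : realType) (X Y : topologicalType) :
  homeomorphic X Y -> valdivia_compact R X -> valdivia_compact R Y.
Proof.
move=> XY [cX [Gamma [K' [XK' dK']]]]; split; last first.
  exists Gamma, K'; split => //.
  exact: homeomorphic_trans (homeomorphic_sym XY) XK'.
have [f [g [fK gK cf cg]]] := XY.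
have -> : [set: Y] = f @` [set: X].
  by apply/seteqP; split => // y _; exists (g y).
by apply: continuous_compact => //; exact: continuous_subspaceT.
Qed.

Lemma homeomorphic_setT (X : topologicalType) : homeomorphic X [set: X].
Proof.
exists (fun x => exist _ x (mem_set I)), set_val; split.
- by [].
- by move=> x; exact: val_inj.
- by apply: set_type_continuous => x; exact: cvg_id.
- exact: initial_continuous.
Qed.

Lemma valdivia_setT (R : realType) (X : topologicalType) :
  valdivia_compact R X <-> valdivia_compact R [set: X].
Proof.
by split; apply: homeomorphic_valdivia;
  [|apply: homeomorphic_sym]; exact: homeomorphic_setT.
Qed.

(** On a line, [uncountable_character] unfolds to the negation of this. *)
Definition countable_character (X : topologicalType) (x : X) : Prop :=
  exists B : set (set X), [/\ countable B, B `<=` nbhs x &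
    forall U, nbhs x U -> exists2 V, B V & V `<=` U].

(* If f g x != 0, some basic neighbourhood V of x misses the zeros of f g; so
   choosing a countably supported point in each V covers the support of x. *)
Lemma countable_character_support (R : realType) (X : topologicalType)
    (A : set X) (Gamma : Type) (f : Gamma -> X -> R) (x : X) :
  sigma_coordinates A f -> A x -> countable_character x ->
  countable [set g | f g x != 0].
Proof.
move=> [cf _ df] Ax [B [cB Bx baseB]].
have pP V : exists y, B V -> [/\ V y, A y & countable [set g | f g y != 0]].
  have [BV|nBV] := pselect (B V); last by exists x.
  have [||y [Vy Ay cy]] := df (interior V).
  + exact: open_interior.
  + by exists x; split => //; exact: (Bx _ BV).
  by exists y => _; split => //; exact: interior_subset.
pose p V := projT1 (cid (pP V)).
have pP' V : B V -> [/\ V (p V), A (p V) & countable [set g | f g (p V) != 0]].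
  exact: projT2 (cid (pP V)).
apply: (@sub_countable _ _ _ (\bigcup_(V in B) [set g | f g (p V) != 0])).
  apply: subset_card_le => g /= fgx.
  have : nbhs (f g x) [set t : R | t != 0].
    by apply: open_nbhs_nbhs; split => //; exact: open_neq.
  have /subspace_continuousP/(_ x Ax) := cf g => /[apply] nU.
  have [V BV sV] := baseB _ nU; have [Vp Ap _] := pP' V BV.
  by exists V => //; exact: sV.
by apply: bigcup_countable => // V BV; have [] := pP' V BV.
Qed.

(** * Order structure of the classes *)

Section compact_line_order.
Context {d : Order.disp_t} {K : orderTopologicalType d}.
Implicit Types (x y z : K) (A N U : set K).

Lemma nbhs_rray x z : (x < z)%O -> nbhs z `]x, +oo[%classic.
Proof.
move=> xz; apply: open_nbhs_nbhs; split; first exact: rray_open.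
by rewrite /= in_itv /= xz.
Qed.

Lemma nbhs_lray x z : (z < x)%O -> nbhs z `]-oo, x[%classic.
Proof.
move=> xz; apply: open_nbhs_nbhs; split; first exact: lray_open.
by rewrite /= in_itv /= xz.
Qed.

(** Otherwise [interior N] would witness that [[x, +oo[] is open at [x]; at the points beyond [x] it
    is open anyway. *)
Lemma interior_left x N : ~ open `[x, +oo[%classic -> nbhs x N ->
  exists y, (y < x)%O /\ interior N y.
Proof.
move=> nox nN; apply: contrapT => H; apply: nox.
rewrite openE => z; rewrite /= in_itv /= andbT le_eqVlt => /predU1P[<-|xz].
  have := nbhs_interior nN; apply: filterS => y Ny; rewrite /= in_itv /= andbT.
  by rewrite leNgt; apply/negP => yx; apply: H; exists y.
apply: (@filterS _ _ _ `]x, +oo[%classic); last exact: nbhs_rray.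
by move=> y; rewrite /= !in_itv /= !andbT; exact: ltW.
Qed.

Lemma interior_right x N : ~ open `]-oo, x]%classic -> nbhs x N ->
  exists y, (x < y)%O /\ interior N y.
Proof.
move=> nox nN; apply: contrapT => H; apply: nox.
rewrite openE => z; rewrite /= in_itv /= le_eqVlt => /predU1P[->|zx].
  have := nbhs_interior nN; apply: filterS => y Ny; rewrite /= in_itv /=.
  by rewrite leNgt; apply/negP => yx; apply: H; exists y.
apply: (@filterS _ _ _ `]-oo, x[%classic); last exact: nbhs_lray.
by move=> y; rewrite /= !in_itv /=; exact: ltW.
Qed.

Lemma line_sim_refl x : line_sim x x.
Proof.
exact: (@RelationClasses.Equivalence_Reflexive _ _ (@line_sim_equivalence d K) x).
Qed.

Lemma line_sim_sym x y : line_sim x y -> line_sim y x.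
Proof.
exact: (@RelationClasses.Equivalence_Symmetric _ _ (@line_sim_equivalence d K) x y).
Qed.

Lemma line_sim_trans x y z : line_sim x y -> line_sim y z -> line_sim x z.
Proof.
exact: (@RelationClasses.Equivalence_Transitive _ _ (@line_sim_equivalence d K) x y z).
Qed.

Lemma line_sim_connected x y : (x <= y)%O -> line_sim x y ->
  connected `[x, y]%classic.
Proof.
move=> xy [[]//|[yx]].
by have -> // : x = y by apply/eqP; rewrite eq_le xy.
Qed.

Lemma line_sim_between x y z : (x <= y)%O -> (y <= z)%O -> line_sim x z ->
  line_sim x y.
Proof.
move=> xy yz /(line_sim_connected (le_trans xy yz)) c; left; split => //.
exact: connected_subitv c.
Qed.

Lemma line_sim_between_r x y z : (x <= y)%O -> (y <= z)%O -> line_sim x z ->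
  line_sim y z.
Proof.
move=> xy yz xz; apply: (line_sim_trans _ xz); apply: line_sim_sym.
exact: line_sim_between yz xz.
Qed.

(** If []-oo, x]] were open, it would cut a proper nonempty clopen part out of [[x, y]]. *)
Lemma line_sim_open_l x y : (x < y)%O -> line_sim x y -> ~ open `]-oo, x]%classic.
Proof.
move=> xy /(line_sim_connected (ltW xy)) c ox.
have H : (`[x, y] `&` `]-oo, x] = `[x, y])%classic.
  apply: c.
  - by exists x; split; rewrite /= in_itv /= ?lexx ?ltW.
  - by exists `]-oo, x]%classic.
  - by exists `]-oo, x]%classic; first exact: lray_closed.
have : `[x, y]%classic y by rewrite /= in_itv /= lexx ltW.
by rewrite -H /= !in_itv /= => -[_]; rewrite leNgt xy.
Qed.

Lemma line_sim_open_r x y : (x < y)%O -> line_sim x y -> ~ open `[y, +oo[%classic.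
Proof.
move=> xy /(line_sim_connected (ltW xy)) c ox.
have H : (`[x, y] `&` `[y, +oo[ = `[x, y])%classic.
  apply: c.
  - by exists y; split; rewrite /= in_itv /= ?lexx ?ltW.
  - by exists `[y, +oo[%classic.
  - by exists `[y, +oo[%classic; first exact: rray_closed.
have : `[x, y]%classic x by rewrite /= in_itv /= lexx ltW.
by rewrite -H /= !in_itv /= => -[_]; rewrite andbT leNgt xy.
Qed.

(** Yields closedness of the classes, components being closed. The point is that a connected set [C]
    is convex. *)
Lemma line_class_component x : line_class x = connected_component [set: K] x.
Proof.
apply/seteqP; split=> [y|y [C [Cx _ cC] Cy]].
  move=> [[xy c]|[yx c]].
    by exists `[x, y]%classic; [split=> //|]; rewrite /= in_itv /= lexx xy.
  by exists `[y, x]%classic; [split=> //|]; rewrite /= in_itv /= lexx yx.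
have conv u v : (u <= v)%O -> C u -> C v -> connected `[u, v]%classic.
  move=> uv Cu Cv.
  (* Clamping to [[u, v]] maps [C] onto it: if [C] missed some [z] of [[u, v]], the part of [C]
     below [z] would be clopen in [C]. *)
  have -> : `[u, v]%classic = (fun z => Order.max u (Order.min v z)) @` C.
    apply/seteqP; split=> [z|_ [z _ <-]] /=; last first.
      by rewrite in_itv /= le_max lexx /= ge_max uv /= ge_min lexx.
    rewrite in_itv /= => /andP[uz zv]; exists z; last first.
      by rewrite (min_r zv) (max_r uz).
    apply: contrapT => nCz.
    have uz' : (u < z)%O.
      by rewrite lt_neqAle uz andbT; apply: contra_notN nCz => /eqP <-.
    have zv' : (z < v)%O.
      by rewrite lt_neqAle zv andbT; apply: contra_notN nCz => /eqP ->.
    have H : C `&` `]-oo, z[%classic = C.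
      apply: cC.
      - by exists u; split; rewrite //= in_itv.
      - by exists `]-oo, z[%classic; first exact: lray_open.
      - exists `]-oo, z]%classic; first exact: lray_closed.
        apply/seteqP; split=> w [Cw] /=; rewrite !in_itv /=.
          by move=> /ltW.
        by rewrite le_eqVlt => /predU1P[wz|//]; rewrite wz in Cw.
    by have := Cv; rewrite -H => -[_]; rewrite /= in_itv /= ltNge zv.
  apply: connected_continuous_connected => //; apply: continuous_subspaceT.
  apply: max_fun_continuous; first by move=> ?; exact: cvg_cst.
  apply: min_fun_continuous; first by move=> ?; exact: cvg_cst.
  by move=> ?; exact: cvg_id.
by have [xy|/ltW yx] := leP x y; [left|right]; split => //; exact: conv.
Qed.

Lemma line_class_closed x : closed (line_class x).
Proof. by rewrite line_class_component; apply: component_closed; exact: closedT. Qed.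

(** * Endpoints of classes and points of K0 *)

Hypothesis compactK : compact [set: K].

(** The sets of points of [A] at or above a given [a] in [A] are closed and generate a proper
    filter; a cluster point lies in all of them. *)
Lemma compact_line_max A : closed A -> A !=set0 ->
  exists a, A a /\ forall x, A x -> (x <= a)%O.
Proof.
move=> clA [a0 Aa0].
pose F := filter_from A (fun a => A `&` `[a, +oo[%classic).
have FF : Filter F.
  apply: filter_from_filter; first by exists a0.
  move=> a b Aa Ab; exists (Order.max a b); first by have [] := leP a b.
  by move=> z [Az]; rewrite /= !in_itv /= !andbT ge_max => /andP[].
have PF : ProperFilter F.
  apply: filter_from_proper => // a Aa; exists a; split => //.
  by rewrite /= in_itv /= lexx.
have [x [_ clx]] := compactK PF filterT.
have Fcl a : A a -> (A `&` `[a, +oo[)%classic x.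
  move=> Aa; have clAa : closed (A `&` `[a, +oo[)
    by apply: closedI => //; exact: rray_closed.
  by rewrite (iffLR (closure_id _) clAa); move: clx; rewrite clusterE; apply; exists a.
exists x; split; first by have [] := Fcl _ Aa0.
by move=> a /Fcl[_]; rewrite /= in_itv /= andbT.
Qed.

Lemma compact_line_min A : closed A -> A !=set0 ->
  exists a, A a /\ forall x, A x -> (a <= x)%O.
Proof.
move=> clA [a0 Aa0].
pose F := filter_from A (fun a => A `&` `]-oo, a]%classic).
have FF : Filter F.
  apply: filter_from_filter; first by exists a0.
  move=> a b Aa Ab; exists (Order.min a b); first by have [] := leP a b.
  by move=> z [Az]; rewrite /= !in_itv /= le_min => /andP[].
have PF : ProperFilter F.
  apply: filter_from_proper => // a Aa; exists a; split => //.
  by rewrite /= in_itv /= lexx.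
have [x [_ clx]] := compactK PF filterT.
have Fcl a : A a -> (A `&` `]-oo, a])%classic x.
  move=> Aa; have clAa : closed (A `&` `]-oo, a])
    by apply: closedI => //; exact: lray_closed.
  by rewrite (iffLR (closure_id _) clAa); move: clx; rewrite clusterE; apply; exists a.
exists x; split; first by have [] := Fcl _ Aa0.
by move=> a /Fcl[_]; rewrite /= in_itv.
Qed.

(** [xget] makes the endpoint total. In a compact line a class, being closed, has a least element,
    so the default is not taken. *)
Definition line_lo x : K :=
  xget x [set a | line_sim x a /\ forall y, line_sim x y -> (a <= y)%O].

Definition line_hi x : K :=
  xget x [set a | line_sim x a /\ forall y, line_sim x y -> (y <= a)%O].

Lemma line_loP x :
  line_sim x (line_lo x) /\ forall y, line_sim x y -> (line_lo x <= y)%O.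
Proof.
have [|a Ha] := compact_line_min (@line_class_closed x).
  by exists x; exact: line_sim_refl.
by rewrite /line_lo; case: xgetP => [b _ []//|/(_ a)].
Qed.

Lemma line_hiP x :
  line_sim x (line_hi x) /\ forall y, line_sim x y -> (y <= line_hi x)%O.
Proof.
have [|a Ha] := compact_line_max (@line_class_closed x).
  by exists x; exact: line_sim_refl.
by rewrite /line_hi; case: xgetP => [b _ []//|/(_ a)].
Qed.

Lemma line_lo_le x : (line_lo x <= x)%O.
Proof. by apply: (line_loP x).2; exact: line_sim_refl. Qed.

Lemma line_hi_ge x : (x <= line_hi x)%O.
Proof. by apply: (line_hiP x).2; exact: line_sim_refl. Qed.

Lemma line_simP x y : line_sim x y <-> (line_lo x <= y <= line_hi x)%O.
Proof.
split=> [xy|/andP[lx xh]].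
  by rewrite (line_loP x).2// (line_hiP x).2.
apply: (line_sim_trans (line_loP x).1); apply: line_sim_between lx xh _.
exact: line_sim_trans (line_sim_sym (line_loP x).1) (line_hiP x).1.
Qed.

Lemma line_lo_eq x y : line_sim x y -> line_lo x = line_lo y.
Proof.
move=> xy; apply/eqP; rewrite eq_le; apply/andP; split.
  by apply: (line_loP x).2; apply: line_sim_trans xy (line_loP y).1.
by apply: (line_loP y).2; apply: line_sim_trans (line_sim_sym xy) (line_loP x).1.
Qed.

Lemma line_hi_eq x y : line_sim x y -> line_hi x = line_hi y.
Proof.
move=> xy; apply/eqP; rewrite eq_le; apply/andP; split; last first.
  by apply: (line_hiP x).2; apply: line_sim_trans xy (line_hiP y).1.
by apply: (line_hiP y).2; apply: line_sim_trans (line_sim_sym xy) (line_hiP x).1.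
Qed.

(** Classes are convex: otherwise [x] would lie in the class of [y], or [line_lo y] in that of
    [x]. *)
Lemma line_hi_lt_lo x y : (x < y)%O -> ~ line_sim x y ->
  (line_hi x < line_lo y)%O.
Proof.
move=> xy nxy; rewrite ltNge; apply/negP => yx; apply: nxy.
have [lyx|/ltW xly] := leP (line_lo y) x.
  apply/line_sim_sym/line_simP; rewrite lyx /=.
  exact: le_trans (ltW xy) (line_hi_ge y).
apply: (line_sim_trans (y := line_lo y)); last exact/line_sim_sym/(line_loP y).1.
by apply/line_simP; rewrite yx andbT (le_trans (line_lo_le x)).
Qed.

(** A point strictly inside its class is removed by the interval between the endpoints. A point
    strictly between equivalent [a] and [b] is equivalent to both, so it is no extremum of its
    class. *)
Lemma line_K0P x : line_K0 x <-> x = line_lo x \/ x = line_hi x.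
Proof.
split=> [[_ nx]|xe].
  apply: contrapT => /not_orP[xl xh]; apply: nx.
  have lx : (line_lo x < x)%O by rewrite lt_neqAle line_lo_le andbT eq_sym; apply/eqP.
  have hx : (x < line_hi x)%O by rewrite lt_neqAle line_hi_ge andbT; apply/eqP.
  exists (line_lo x, line_hi x); last by rewrite /= in_itv /= lx.
  split => /=; first exact: lt_trans hx.
  exact: line_sim_trans (line_sim_sym (line_loP x).1) (line_hiP x).1.
split=> // -[[a b] [/= ab sab]]; rewrite in_itv /= => /andP[ax xb].
have sax := line_sim_between (ltW ax) (ltW xb) sab.
have sxb := line_sim_between_r (ltW ax) (ltW xb) sab.
case: xe => xE.
  by have := (line_loP x).2 a (line_sim_sym sax); rewrite -xE leNgt ax.
by have := (line_hiP x).2 b sxb; rewrite -xE leNgt xb.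
Qed.

Lemma line_lo_id x : line_lo (line_lo x) = line_lo x.
Proof. by apply/esym/line_lo_eq/(line_loP x).1. Qed.

Lemma line_hi_id x : line_hi (line_hi x) = line_hi x.
Proof. by apply/esym/line_hi_eq/(line_hiP x).1. Qed.

Lemma line_lo_le_hi x : (line_lo x <= line_hi x)%O.
Proof. exact: le_trans (line_lo_le x) (line_hi_ge x). Qed.

Lemma line_lo_sim_hi x : line_sim (line_lo x) (line_hi x).
Proof. exact: line_sim_trans (line_sim_sym (line_loP x).1) (line_hiP x).1. Qed.

Lemma line_hi_lo x : line_hi (line_lo x) = line_hi x.
Proof. by apply/esym/line_hi_eq/(line_loP x).1. Qed.

Lemma line_K0_lo x : line_K0 (line_lo x).
Proof. by apply/line_K0P; left; rewrite line_lo_id. Qed.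

Lemma line_K0_hi x : line_K0 (line_hi x).
Proof. by apply/line_K0P; right; rewrite line_hi_id. Qed.

Lemma line_K0_closed : closed (@line_K0 d K).
Proof.
rewrite /line_K0 setTD; apply: open_closedC.
by apply: bigcup_open => ab _; exact: itv_open.
Qed.

(** Away from the class of [z], whole classes shrink to [z]. This allows replacing a point near [z]
    by another point of its class, such as an endpoint. *)
Lemma nbhs_classes z N : nbhs z N ->
  \forall y \near z, ~ line_sim z y -> `[line_lo y, line_hi y]%classic `<=` N.
Proof.
rewrite itv_nbhsE => -[i [oi zi] siN].
have conv u v w : u \in i -> w \in i -> (u <= v <= w)%O -> v \in i.
  case: (i) => l r; rewrite !itv_boundlr => /andP[lu _] /andP[_ wr] /andP[uv vw].
  rewrite (le_trans lu) ?bnd_simp//=.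
  by apply: le_trans wr; rewrite bnd_simp.
have ni : nbhs z [set` i].
  by apply: open_nbhs_nbhs; split => //; exact: itv_open_ends_open.
(* If the convex neighbourhood [i] contains some [l < z] of another class, every class strictly
   between those of [l] and [z] lies in [i]. If not, only the class of [z] occurs nearby on this
   side. *)
have left : \forall y \near z, (y < z)%O -> ~ line_sim z y ->
    `[line_lo y, line_hi y]%classic `<=` N.
  have [[l [li lz nl]]|H] := pselect (exists l, [/\ l \in i, (l < z)%O & ~ line_sim z l]).
    apply: (@filterS _ _ _ `]line_hi l, +oo[%classic); last first.
      apply: nbhs_rray; apply: lt_le_trans (line_hi_lt_lo lz _) (line_lo_le z).
      by move=> /line_sim_sym.
    move=> y; rewrite /= in_itv /= andbT => ly yz nzy w; rewrite /= in_itv /=.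
    move=> /andP[lw wh]; apply: siN; apply: (conv l w z) => //.
    have nly : ~ line_sim l y by move=> /line_simP/andP[_]; rewrite leNgt ly.
    have hl := line_hi_lt_lo (le_lt_trans (line_hi_ge l) ly) nly.
    rewrite (le_trans (le_trans (line_hi_ge l) (ltW hl)))//=.
    apply: (le_trans wh); apply: le_trans (line_lo_le z); apply: ltW.
    by apply: line_hi_lt_lo => // /line_sim_sym.
  by apply: filterS ni => y iy yz nzy; exfalso; apply: H; exists y.
have right : \forall y \near z, (z < y)%O -> ~ line_sim z y ->
    `[line_lo y, line_hi y]%classic `<=` N.
  have [[l [li lz nl]]|H] := pselect (exists l, [/\ l \in i, (z < l)%O & ~ line_sim z l]).
    apply: (@filterS _ _ _ `]-oo, line_lo l[%classic); last first.
      apply: nbhs_lray; exact: le_lt_trans (line_hi_ge z) (line_hi_lt_lo lz nl).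
    move=> y; rewrite /= in_itv /= => ly yz nzy w; rewrite /= in_itv /=.
    move=> /andP[lw wh]; apply: siN; apply: (conv z w l) => //.
    have nly : ~ line_sim y l.
      by move=> /line_sim_sym/line_simP/andP[]; rewrite leNgt ly.
    rewrite (le_trans wh) ?andbT; last first.
      apply: le_trans (line_lo_le l); apply: ltW; apply: line_hi_lt_lo => //.
      exact: lt_le_trans ly (line_lo_le l).
    apply: le_trans lw; apply: le_trans (line_hi_ge z) _; apply: ltW.
    exact: line_hi_lt_lo.
  by apply: filterS ni => y iy yz nzy; exfalso; apply: H; exists y.
near=> y => nzy; have [yz|zy|yz] := ltgtP y z.
- by apply: (near left y).
- by apply: (near right y).
- by exfalso; apply: nzy; rewrite yz; exact: line_sim_refl.
Unshelve. all: by end_near. Qed.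

End compact_line_order.

(** * Points that are not isolated from one side *)

Lemma filter_seq (T : Type) (F : set_system T) (I : eqType) (s : seq I)
    (P : I -> set T) : Filter F ->
  (forall i, i \in s -> F (P i)) -> F [set z | forall i, i \in s -> P i z].
Proof.
move=> FF; elim: s => [|i s IH] H; first by apply: filterE.
have Fi := H i (mem_head i s).
have Fs : F [set z | forall j, j \in s -> P j z].
  by apply: IH => j js; apply: H; rewrite in_cons js orbT.
apply: filterS (filterI Fi Fs) => z [Pz sz] j; rewrite in_cons.
by move=> /predU1P[->//|]; exact: sz.
Qed.

(** [f c] is a cluster point of [f (u t)], and in a Hausdorff space a limit is the only cluster
    point. *)
Lemma cluster_cvg_eq (X Y : topologicalType) (T : Type) (F : set_system T)
    (u : T -> X) (c : X) (f : X -> Y) (v : Y) : hausdorff_space Y ->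
  ProperFilter F -> {for c, continuous f} -> cluster (u @ F) c ->
  f (u t) @[t --> F] --> v -> f c = v.
Proof.
move=> hY FF cf clc cv; apply: hY => A B nA nB.
have [||z [[t Bt <-] Az]] := clc (u @` [set t | B (f (u t))]) (f @^-1` A).
- have := cv _ nB; apply: (@filterS _ F) => t Bt /=.
  by exists t.
- exact: cf.
by exists (f (u t)).
Qed.

Section two_sided.
Context {d : Order.disp_t} {K : orderTopologicalType d}.
Hypothesis compactK : compact [set: K].

(* Choose countably supported points p n < x < q n, such that f g (p n) and
   f g (q n) tend to f g x whenever g lies in the support of some p k or q k.
   Cluster points of p and of q then have the same coordinates; as the former
   are <= x and the latter >= x, they are all equal to x. *)
Lemma two_sided_countable_character (R : realType) (Gamma : Type)
    (f : Gamma -> K -> R) (x : K) : sigma_coordinates [set: K] f ->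
  ~ open `[x, +oo[%classic -> ~ open `]-oo, x]%classic ->
  countable_character x.
Proof.
move=> [cf injf df] nlx nrx.
have {}cf g : continuous (f g) by apply/continuous_subspace_setT/cf.
pose supp y := [set g | f g y != 0].
have codeP y : exists c : Gamma -> nat, countable (supp y) ->
    {in supp y &, injective c}.
  have [cy|ncy] := pselect (countable (supp y)); last by exists (fun=> 0%N).
  by have /countable_injP[c ic] := cy; exists c.
pose code y := projT1 (cid (codeP y)).
have code_inj y : countable (supp y) -> {in supp y &, injective (code y)}.
  exact: projT2 (cid (codeP y)).
(* Asks that the coordinates of code at most [n] in the countable supports of points of [L] vary by
   less than 1/(n+1) from [x]. Each pair concerns at most one coordinate, so these are finitely many
   conditions. *)
pose N (L : seq K) (n : nat) := [set z | forall yj : K * nat,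
  yj \in [seq (y, j) | y <- L, j <- iota 0 n.+1] -> countable (supp yj.1) ->
  forall g, supp yj.1 g -> code yj.1 g = yj.2 -> `|f g x - f g z| < n.+1%:R^-1].
have nN L n : nbhs x (N L n).
  apply: filter_seq => -[y j] _ /=.
  have [[cy [g [yg cgj]]]|H] := pselect (countable (supp y) /\
      exists g, supp y g /\ code y g = j); last first.
    by apply: filterE => z cy g yg cgj; exfalso; apply: H; split => //; exists g.
  have /cvgrPdist_lt/(_ n.+1%:R^-1) := cf g x.
  rewrite invr_gt0 ltr0n => /(_ isT); apply: filterS => z zx _ g' yg' cg'.
  by rewrite (code_inj y cy g' g) ?inE// cgj.
have exh L n : exists pq : K * K,
    [/\ (pq.1 < x)%O, (x < pq.2)%O, N L n pq.1 & N L n pq.2] /\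
    countable (supp pq.1) /\ countable (supp pq.2).
  have [y [yx Ny]] := interior_left nlx (nN L n).
  have [z [xz Nz]] := interior_right nrx (nN L n).
  have [||p [[/= px Np] _ cp]] := df (`]-oo, x[%classic `&` interior (N L n)).
  - by apply: openI; [exact: lray_open|exact: open_interior].
  - by exists y; split => //; split => //; rewrite /= in_itv.
  have [||q [[/= qx Nq] _ cq]] := df (`]x, +oo[%classic `&` interior (N L n)).
  - by apply: openI; [exact: rray_open|exact: open_interior].
  - by exists z; split => //; split => //; rewrite /= in_itv /= xz.
  exists (p, q); split => //; split.
  - by move: px; rewrite in_itv.
  - by move: qx; rewrite in_itv /= andbT.
  - exact: interior_subset Np.
  - exact: interior_subset Nq.
pose h L n := projT1 (cid (exh L n)).
have hP L n : [/\ ((h L n).1 < x)%O, (x < (h L n).2)%O, N L n (h L n).1 &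
    N L n (h L n).2] /\ countable (supp (h L n).1) /\ countable (supp (h L n).2).
  exact: projT2 (cid (exh L n)).
(* [Ls n] lists the points chosen before stage [n], which then picks its pair in [N (Ls n) n]. *)
pose Ls := fix Ls n := if n is m.+1 then
  [:: (h (Ls m) m).1, (h (Ls m) m).2 & Ls m] else [::].
pose p n := (h (Ls n) n).1; pose q n := (h (Ls n) n).2.
have px n : (p n < x)%O by have [[]] := hP (Ls n) n.
have xq n : (x < q n)%O by have [[]] := hP (Ls n) n.
have LsP k n : (k < n)%N -> (p k \in Ls n) && (q k \in Ls n).
  elim: n => // n IH; rewrite ltnS leq_eqVlt => /predU1P[->|/IH/andP[pk qk]].
    by rewrite /= !in_cons !eqxx !orbT.
  by rewrite /= !in_cons pk qk !orbT.
pose S := [set g | exists k, supp (p k) g \/ supp (q k) g].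
(* The common limit along [p] and [q]: a coordinate outside [S] vanishes at all chosen points. *)
pose v g := if `[< S g >] then f g x else 0.
have cvS g : S g -> \forall n \near \oo,
    `|f g x - f g (p n)| < n.+1%:R^-1 /\ `|f g x - f g (q n)| < n.+1%:R^-1.
  move=> [k Sk].
  have [y [yg cy yL]] : exists y, [/\ supp y g, countable (supp y) &
      forall n, (k < n)%N -> y \in Ls n].
    have [_ [cp cq]] := hP (Ls k) k.
    by case: Sk => Sk; [exists (p k)|exists (q k)]; split => // n /LsP/andP[].
  near=> n.
  have yj : (y, code y g) \in [seq (y, j) | y <- Ls n, j <- iota 0 n.+1].
    apply/allpairsP; exists (y, code y g); split; last by [].
      by apply: yL; near: n; exact: nbhs_infty_gt.
    by rewrite mem_iota add0n ltnS; near: n; exact: nbhs_infty_ge.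
  by have [[_ _ Np Nq] _] := hP (Ls n) n; split; [exact: (Np _ yj)|exact: (Nq _ yj)].
have cvp g : f g (p n) @[n --> \oo] --> v g.
  rewrite /v; case: asboolP => [Sg|nSg].
    apply/cvgrPdist_lt => e e0; near=> n.
    apply: (@lt_trans _ _ n.+1%:R^-1).
      by have [] := near (cvS g Sg) n.
    by near: n; exact: (near_infty_natSinv_lt (PosNum e0)).
  apply: cvg_near_cst; apply: nearW => n; apply: contra_notP nSg => /eqP pg.
  by exists n; left.
have cvq g : f g (q n) @[n --> \oo] --> v g.
  rewrite /v; case: asboolP => [Sg|nSg].
    apply/cvgrPdist_lt => e e0; near=> n.
    apply: (@lt_trans _ _ n.+1%:R^-1).
      by have [] := near (cvS g Sg) n.
    by near: n; exact: (near_infty_natSinv_lt (PosNum e0)).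
  apply: cvg_near_cst; apply: nearW => n; apply: contra_notP nSg => /eqP pg.
  by exists n; right.
have [c [_ clc]] := compactK (fmap_proper_filter p eventually_filter) filterT.
have [c' [_ clc']] := compactK (fmap_proper_filter q eventually_filter) filterT.
have cc' : c = c'.
  apply: injf => // g.
  rewrite (cluster_cvg_eq (@Rhausdorff R) _ (cf g c) clc (cvp g)).
  by rewrite (cluster_cvg_eq (@Rhausdorff R) _ (cf g c') clc' (cvq g)).
have rp : (p @ \oo) (range p) by exists 0%N => // n _; exists n.
have rq : (q @ \oo) (range q) by exists 0%N => // n _; exists n.
have cx : (c <= x)%O.
  rewrite leNgt; apply/negP => /nbhs_rray nc.
  have [z [[n _ <-]]] := clc _ _ rp nc.
  by rewrite /= in_itv /= andbT ltNge (ltW (px n)).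
have xc' : (x <= c')%O.
  rewrite leNgt; apply/negP => /nbhs_lray nc.
  have [z [[n _ <-]]] := clc' _ _ rq nc.
  by rewrite /= in_itv /= ltNge (ltW (xq n)).
have c'x : c' = x by apply/eqP; rewrite eq_le xc' -cc' cx.
rewrite c'x in cc' clc' *; rewrite cc' in clc.
(* Both sequences cluster at [x], so every convex neighbourhood of [x] contains some [p n] and
   [q m], and the interval between them. *)
exists (range (fun nm : nat * nat => `]p nm.1, q nm.2[%classic)); split.
- exact: (@sub_countable _ _ _ [set: nat * nat] (card_image_le _ _)).
- move=> _ [[n m] _ <-]; apply: open_nbhs_nbhs; split; first exact: itv_open.
  by rewrite /= in_itv /= px xq.
- move=> U; rewrite itv_nbhsE => -[i [oi xi] siU].
  have ni : nbhs x [set` i].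
    by apply: open_nbhs_nbhs; split => //; exact: itv_open_ends_open.
  have [z [[n _ <-] pi]] := clc _ _ rp ni.
  have [z' [[m _ <-] qi]] := clc' _ _ rq ni.
  exists `]p n, q m[%classic; first by exists (n, m).
  move=> y; rewrite /= in_itv /= => /andP[py yq]; apply: siU => /=.
  move: pi qi; case: (i) => l r /=; rewrite !itv_boundlr.
  move=> /andP[lp _] /andP[_ qr]; apply/andP; split.
    by apply: le_trans lp _; rewrite bnd_simp ltW.
  by apply: le_trans qr; rewrite bnd_simp ltW.
Unshelve. all: by end_near. Qed.

End two_sided.

(** * Classes and K0 in a Valdivia compact line *)

Section valdivia_line.
Context {d : Order.disp_t} {K : orderTopologicalType d}.
Hypothesis compactK : compact [set: K].
Context {R : realType} {Gamma : Type} (f : Gamma -> K -> R).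
Hypothesis sigf : sigma_coordinates [set: K] f.
Implicit Types (x y z : K).

Let supp y := [set g | f g y != 0].

(** Connectedness prevents [x] from being isolated on the right, so [N] contains a nonempty open set
    between [x] and [y], hence a good point. *)
Lemma support_near_right x y (N : set K) : (x < y)%O -> line_sim x y ->
  nbhs x N -> exists w, [/\ (x < w < y)%O, N w & countable (supp w)].
Proof.
move=> xy sxy nN; have [_ _ df] := sigf.
have [z [xz Nz]] := interior_right (line_sim_open_l xy sxy)
  (filterI nN (nbhs_lray xy)).
have [||w [[/interior_subset[Nw wy] xw] _ cw]] :=
    df (interior (N `&` `]-oo, y[) `&` `]x, +oo[)%classic.
- by apply: openI; [exact: open_interior|exact: rray_open].
- by exists z; split => //; split => //; rewrite /= in_itv /= xz.
exists w; split => //.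
by move: wy xw; rewrite /= !in_itv /= andbT => -> ->.
Qed.

Lemma support_near_left x y (N : set K) : (x < y)%O -> line_sim x y ->
  nbhs y N -> exists w, [/\ (x < w < y)%O, N w & countable (supp w)].
Proof.
move=> xy sxy nN; have [_ _ df] := sigf.
have [z [zy Nz]] := interior_left (line_sim_open_r xy sxy)
  (filterI nN (nbhs_rray xy)).
have [||w [[/interior_subset[Nw xw] wy] _ cw]] :=
    df (interior (N `&` `]x, +oo[) `&` `]-oo, y[)%classic.
- by apply: openI; [exact: open_interior|exact: lray_open].
- by exists z; split => //; split => //; rewrite /= in_itv /= zy.
exists w; split => //.
by move: wy xw; rewrite /= !in_itv /= andbT => -> ->.
Qed.

(** In a nontrivial class every point is a limit of good points of that class, so [f] itself
    restricts. *)
Lemma line_class_coordinates x : exists (Gamma' : Type) (f' : Gamma' -> K -> R),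
  sigma_coordinates (line_class x) f'.
Proof.
have [[y [xy yx]]|H] := pselect (exists y, line_sim x y /\ y != x); last first.
  have eqx y : line_sim x y -> y = x.
    by move=> xy; apply: contrapT => /eqP yx; apply: H; exists y.
  (* The point of a trivial class may have uncountable support under [f], so the empty family is
     taken. *)
  exists void, (fun g _ => of_void R g); split => [[]||].
    by move=> y z /eqx -> /eqx ->.
  move=> U oU [z [Uz Cz]]; by exists z; split.
have [cf injf df] := sigf.
exists Gamma, f; split.
- by move=> g; apply: continuous_subspaceT; apply/continuous_subspace_setT/cf.
- by move=> u v _ _; exact: injf.
move=> U oU [z [Uz Cz]].
have nU : nbhs z U by apply: open_nbhs_nbhs; split.
have [z' [zz' z'z]] : exists z', line_sim z z' /\ z' != z.
  have [<-|xz] := eqVneq x z; first by exists y.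
  by exists x; split => //; exact: line_sim_sym.
have [zltz'|z'ltz|zE] := ltgtP z z'; last by rewrite zE eqxx in z'z.
- have [w [/andP[zw wz'] Uw cw]] := support_near_right zltz' zz' nU.
  exists w; split => //; apply: (line_sim_trans Cz).
  exact: line_sim_between (ltW zw) (ltW wz') zz'.
- have [w [/andP[z'w wz] Uw cw]] := support_near_left z'ltz (line_sim_sym zz') nU.
  exists w; split => //; apply: (line_sim_trans Cz); apply: line_sim_sym.
  exact: line_sim_between_r (ltW z'w) (ltW wz) (line_sim_sym zz').
Qed.

(** Two distinct good points, one for each endpoint, so that both endpoints can be moved without
    being identified. *)
Lemma interior_supports x : exists cd : K * K, (line_lo x < line_hi x)%O ->
  [/\ (line_lo x < cd.1)%O, (cd.1 < cd.2)%O, (cd.2 < line_hi x)%O,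
      countable (supp cd.1) & countable (supp cd.2)].
Proof.
have [lh|nlh] := pselect (line_lo x < line_hi x)%O; last by exists (x, x).
have slh : line_sim (line_lo x) (line_hi x).
  exact: line_lo_sim_hi.
have [c [/andP[lc ch] _ cc]] := support_near_right lh slh filterT.
have sch := line_sim_between_r (ltW lc) (ltW ch) slh.
have [e [/andP[ce eh] _ cd]] := support_near_right ch sch filterT.
by exists (c, e).
Qed.

(** The choice is made at [line_lo x] so as to depend only on the class of [x]. *)
Let inner x : K * K := projT1 (cid (interior_supports (line_lo x))).

Let innerP x : (line_lo x < line_hi x)%O ->
  [/\ (line_lo x < (inner x).1)%O, ((inner x).1 < (inner x).2)%O,
      ((inner x).2 < line_hi x)%O, countable (supp (inner x).1) &
      countable (supp (inner x).2)].
Proof.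
by rewrite /inner; case: (cid _) => -[c e] /=; rewrite line_lo_id// line_hi_lo.
Qed.

(* An endpoint of a nontrivial class which shift leaves fixed is a limit from
   both sides in K, hence already countably supported. *)
Let shift x : K :=
  if `[< line_lo x < line_hi x /\ x = line_lo x /\ open `[x, +oo[%classic >]%O
  then (inner x).1 else
  if `[< line_lo x < line_hi x /\ x = line_hi x /\ open `]-oo, x]%classic >]%O
  then (inner x).2 else x.

Let shiftP x :
  [\/ shift x = x,
   [/\ x = line_lo x, open `[x, +oo[%classic,
       (line_lo x < shift x < line_hi x)%O & countable (supp (shift x))] |
   [/\ x = line_hi x, open `]-oo, x]%classic,
       (line_lo x < shift x < line_hi x)%O & countable (supp (shift x))]].
Proof.
rewrite /shift; case: asboolP => [[lh [xE ox]]|_].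
  have [lc ce eh cc _] := innerP lh.
  by apply: Or32; split => //; rewrite lc (lt_trans ce).
case: asboolP => [[lh [xE ox]]|_]; last exact: Or31.
have [lc ce eh _ cc] := innerP lh.
by apply: Or33; split => //; rewrite eh (lt_trans lc).
Qed.

Let shift_sim x : line_sim x (shift x).
Proof.
have [->|[_ _ /andP[lx xh] _]|[_ _ /andP[lx xh] _]] := shiftP x.
- exact: line_sim_refl.
- by apply/line_simP => //; rewrite !ltW.
- by apply/line_simP => //; rewrite !ltW.
Qed.

Let shift_inj x y : line_K0 x -> line_K0 y -> shift x = shift y -> x = y.
Proof.
move=> /(line_K0P compactK) Kx /(line_K0P compactK) Ky E.
have sxy : line_sim x y.
  by apply: line_sim_trans (shift_sim x) _; rewrite E; exact/line_sim_sym/shift_sim.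
have lE := line_lo_eq compactK sxy; have hE := line_hi_eq compactK sxy.
have [lh|lh] := eqVneq (line_lo x) (line_hi x).
  by case: Kx Ky => -> [->|->]; rewrite -?lE -?hE ?lh.
have lh' : (line_lo x < line_hi x)%O.
  by rewrite lt_neqAle lh line_lo_le_hi.
have iE : inner x = inner y by rewrite /inner lE.
have [lc ce eh _ _] := innerP lh'; move: E; rewrite /shift -iE -lE -hE.
have neq (u v : K) : (u < v)%O -> u <> v by move=> /lt_eqF/eqP.
(* The two endpoints and the two inner points are pairwise distinct; this settles all cases of the
   definition of [shift]. *)
have := neq _ _ lh'; have := neq _ _ lc; have := neq _ _ ce; have := neq _ _ eh.
have := neq _ _ (lt_trans lc ce); have := neq _ _ (lt_trans ce eh).
move: Kx Ky; rewrite -lE -hE.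
by do ![case: asboolP => [[_ [? _]]|_]]; intuition congruence.
Qed.

(** K0 meets the class of [z] only in its endpoints, and a ray around [z] excludes the other one. *)
Let K0_near_class z : line_K0 z ->
  \forall y \near z, line_K0 y -> line_sim z y -> y = z.
Proof.
move=> /(line_K0P compactK) Kz.
have E y : line_K0 y -> line_sim z y -> y = line_lo z \/ y = line_hi z.
  move=> /(line_K0P compactK) Ky zy.
  by rewrite (line_lo_eq compactK zy) (line_hi_eq compactK zy).
have [lh|lh] := eqVneq (line_lo z) (line_hi z).
  apply: filterE => y Ky zy; have := E y Ky zy; rewrite -lh.
  have -> : line_lo z = z by case: Kz; rewrite -?lh.
  by case.
have lh' : (line_lo z < line_hi z)%O.
  by rewrite lt_neqAle lh line_lo_le_hi.
case: Kz => zE.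
- apply: (@filterS _ _ _ `]-oo, line_hi z[%classic); last first.
    by apply: nbhs_lray; rewrite {1}zE.
  move=> y; rewrite /= in_itv /= => yh Ky zy; case: (E y Ky zy) => yE.
    by rewrite yE -zE.
  by rewrite yE ltxx in yh.
- apply: (@filterS _ _ _ `]line_lo z, +oo[%classic); last first.
    by apply: nbhs_rray; rewrite {2}zE.
  move=> y; rewrite /= in_itv /= andbT => yl Ky zy; case: (E y Ky zy) => yE.
    by rewrite yE ltxx in yl.
  by rewrite yE -zE.
Qed.

Let shift_support x : line_K0 x -> (line_lo x < line_hi x)%O ->
  countable (supp (shift x)).
Proof.
move=> /(line_K0P compactK) Kx lh.
have slh : line_sim (line_lo x) (line_hi x).
  exact: line_lo_sim_hi.
have [sx|[]//|[]//] := shiftP x.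
(* [x] is not isolated from the inner side, by connectedness, nor from the outer side, because
   [shift] fixes it. *)
have [nl nr] : ~ open `[x, +oo[%classic /\ ~ open `]-oo, x]%classic.
  case: Kx => xE; split.
  - move=> ox; move: sx; rewrite /shift.
    case: asboolP => [_|H]; last by exfalso; apply: H.
    by case: (innerP lh) => + _ _ _ _ cx; rewrite cx -xE ltxx.
  - by rewrite xE; exact: line_sim_open_l lh slh.
  - by rewrite xE; exact: line_sim_open_r lh slh.
  - move=> ox; move: sx; rewrite /shift; case: asboolP => [[_ [xl _]]|_].
      by move: lh; rewrite -xl -xE ltxx.
    case: asboolP => [_|H]; last by exfalso; apply: H.
    by case: (innerP lh) => _ _ + _ _ ex; rewrite ex -xE ltxx.
rewrite sx; apply: (countable_character_support sigf) => //.
exact: two_sided_countable_character sigf nl nr.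
Qed.

Lemma line_K0_coordinates :
  exists f' : Gamma -> K -> R, sigma_coordinates (@line_K0 d K) f'.
Proof.
exists (fun g x => f g (shift x)).
have [cf injf df] := sigf.
have {}cf g : continuous (f g) by apply/continuous_subspace_setT/cf.
split.
- move=> g; apply/subspace_continuousP => z Kz A.
  change (nbhs (f g (shift z)) A ->
    \forall y \near z, line_K0 y -> A (f g (shift y))) => nA.
  have near_z := K0_near_class Kz.
  have nfz : A (f g (shift z)) by exact: nbhs_singleton.
  have [sz|[zE oz lh _]|[zE oz lh _]] := shiftP z.
  (* A point of another class near [z] has its shift in the same class, on which [f g] takes values
     in [A]. *)
  + rewrite sz in nA; have near_cl := nbhs_classes compactK (cf g z A nA).
    apply: filterS (filterI near_z near_cl) => y [yz ycl] Ky.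
    have [/(yz Ky) -> //|nzy] := pselect (line_sim z y).
    apply: ycl => //; rewrite /= in_itv /=.
    by apply/line_simP => //; exact: shift_sim.
  (* Here [z] is isolated in K0: it is isolated from the left in [K], and K0 has no point strictly
     between [z] and [line_hi z]. *)
  + have zh : (z < line_hi z)%O.
      by case/andP: lh => ls sh; rewrite {1}zE; exact: lt_trans sh.
    apply: filterS (filterI near_z (filterI (open_nbhs_nbhs (conj oz _))
      (nbhs_lray zh))); last by rewrite /= in_itv /= lexx.
    move=> y [yz []]; rewrite /= !in_itv /= andbT => zy yh Ky.
    rewrite (yz Ky) //; apply/line_simP => //.
    by rewrite -zE zy ltW.
  + have lz : (line_lo z < z)%O.
      by case/andP: lh => ls sh; rewrite {2}zE; exact: lt_trans sh.
    apply: filterS (filterI near_z (filterI (open_nbhs_nbhs (conj oz _))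
      (nbhs_rray lz))); last by rewrite /= in_itv /= lexx.
    move=> y [yz []]; rewrite /= !in_itv /= andbT => zy yh Ky.
    rewrite (yz Ky) //; apply/line_simP => //.
    by rewrite -zE zy ltW.
- by move=> x y Kx Ky E; apply: shift_inj => //; exact: injf.
move=> U oU [x [Ux Kx]].
have [lh|hl] := ltP (line_lo x) (line_hi x).
  by exists x; split => //; exact: shift_support.
have lhx : line_lo x = x /\ line_hi x = x.
  have := line_lo_le compactK x; have := line_hi_ge compactK x => xh lx.
  split; apply/eqP; rewrite eq_le ?lx ?xh ?andbT /=.
    exact: le_trans hl.
  exact: le_trans lx.
have near_cl := nbhs_classes compactK (open_nbhs_nbhs (conj oU Ux)).
move: near_cl; rewrite /prop_near1 nbhsE => -[V [oV Vx] VW].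
have [|y [/VW /= Wy _ cy]] := df V oV; first by exists x.
have fixed z : line_lo z = line_hi z -> shift z = z.
  have [//|[_ _ /andP[lz zh] _]|[_ _ /andP[lz zh] _]] := shiftP z;
    by move=> E; move: (lt_trans lz zh); rewrite E ltxx.
have [yx|nyx] := pselect (line_sim x y).
  have yE : y = x.
    apply/eqP; rewrite eq_le; have /line_simP := yx.
    by move=> /(_ compactK); rewrite lhx.1 lhx.2 andbC.
  by exists x; split => //; rewrite fixed ?lhx.1 ?lhx.2 // -yE.
have lhy : (line_lo y <= line_hi y)%O.
  exact: line_lo_le_hi.
have llE := line_lo_id compactK y.
have lhE : line_hi (line_lo y) = line_hi y by exact: line_hi_lo.
(* The good point [y] need not lie in K0. The lower endpoint of its class does, and it lies in [U]
   because the whole class does. *)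
exists (line_lo y); split.
- by apply: (Wy nyx); rewrite /= in_itv /= lexx.
- exact: line_K0_lo.
have [lh|hl'] := ltP (line_lo y) (line_hi y).
  by apply: shift_support; [exact: line_K0_lo|rewrite llE lhE].
have E : line_lo y = line_hi y by apply/eqP; rewrite eq_le lhy.
rewrite fixed; last by rewrite llE lhE.
suff -> : line_lo y = y by [].
apply/eqP; rewrite eq_le line_lo_le// E line_hi_ge//.
Qed.

End valdivia_line.

(** * Functions supported on a class *)

(** Urysohn functions separate [a] from the complements of the interiors of countably many basic
    neighbourhoods; each other point lies outside one of these. *)
Lemma countable_character_cozero (R : realType) (X : topologicalType) (a : X) :
  compact [set: X] -> hausdorff_space X -> countable_character a ->
  exists w : nat -> X -> R, [/\ forall n, continuous (w n),
    forall n, w n a = 0 & forall x, x != a -> exists n, w n x != 0].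
Proof.
move=> cX hX [B [cB Ba baseB]].
have /countable_injP[c injc] := cB.
pose V n := [set V | B V /\ c V = n].
pose w n : X -> R := Urysohn [set a] (~` interior (xget setT (V n))).
have sep A : nbhs a A -> uniform_separator [set a] (~` interior A).
  move=> nA; apply: normal_uniform_separator.
  - exact: compact_normal.
  - exact: (compact_closed hX (@compact_set1 _ _)).
  - by apply: open_closedC; exact: open_interior.
  - by rewrite -subset0 => x [->] /(_ nA).
have nV n : nbhs a (xget setT (V n)).
  by case: xgetP => [W _ [BW _]|_]; [exact: Ba|exact: filterT].
exists w; split.
- by move=> n; exact: Urysohn_continuous.
- by move=> n; have := Urysohn_sub0 (sep _ (nV n)) (R := R); apply; exists a.
move=> x xa.
have [W BW Wx] : exists2 W, B W & ~ W x.
  have : nbhs a (~` [set x]).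
    apply: open_nbhs_nbhs; split; last by apply/eqP; rewrite eq_sym.
    by apply: closed_openC; exact: (compact_closed hX (@compact_set1 _ _)).
  by move=> /baseB[W BW sW]; exists W => // /sW; apply.
exists (c W).
have VW : xget setT (V (c W)) = W.
  case: xgetP => [W' _ [BW' cW']|/(_ W)]; last by case.
  by apply: injc; rewrite ?inE.
rewrite (_ : w (c W) x = 1) ?oner_eq0//.
have := Urysohn_sub1 (sep _ (nV (c W))) (R := R); apply; exists x => //.
by rewrite VW => /interior_subset.
Qed.

Section interpolation.
Context {d : Order.disp_t} {K : orderTopologicalType d}.
Hypothesis compactK : compact [set: K].
Implicit Types (a x y z : K).

Lemma continuous_max_line a : continuous (fun x => Order.max a x).
Proof.
apply: max_fun_continuous => x; first exact: cvg_cst.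
exact: cvg_id.
Qed.

Lemma continuous_min_line a : continuous (fun x => Order.min a x).
Proof.
apply: min_fun_continuous => x; first exact: cvg_cst.
exact: cvg_id.
Qed.

Lemma clopen_indicator_continuous (R : realType) (X : topologicalType)
    (A : set X) : open A -> closed A -> continuous (\1_A : X -> R).
Proof.
move=> oA cA x.
have [Ax|nAx] := pselect (A x).
  apply: cvg_near_cst; have := open_nbhs_nbhs (conj oA Ax).
  by apply: filterS => y Ay; rewrite !indicE !mem_set.
apply: cvg_near_cst; have := open_nbhs_nbhs (conj (closed_openC cA) nAx).
by apply: filterS => y Ay; rewrite !indicE !memNset.
Qed.

(** The indicator of a clopen ray, or else functions with sole common zero [a] composed with
    [Order.max a], which collapses the points below [a] to [a]. The value at [a] is left free, as
    the indicator is 1 there. *)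
Lemma right_cozero (R : realType) a :
  open `[a, +oo[%classic \/ countable_character a ->
  exists u : nat -> K -> R, [/\ forall n, continuous (u n),
    forall n x, (x < a)%O -> u n x = 0 &
    forall x, (a < x)%O -> exists n, u n x != 0].
Proof.
case=> [oa|ca].
  exists (fun _ => \1_(`[a, +oo[%classic)); split.
  - by move=> _; apply: clopen_indicator_continuous => //; exact: rray_closed.
  - by move=> _ x xa; rewrite indicE memNset//= in_itv /= andbT leNgt xa.
  - move=> x ax; exists 0%N; rewrite indicE mem_set ?oner_eq0//=.
    by rewrite in_itv /= andbT ltW.
have [w [cw wa w0]] :=
  countable_character_cozero R compactK (@order_hausdorff d K) ca.
exists (fun n x => w n (Order.max a x)); split.
- move=> n x; apply: continuous_comp; first exact: continuous_max_line.
  exact: cw.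
- by move=> n x /ltW xa; rewrite max_l.
- move=> x ax; rewrite max_r ?ltW//; apply: w0.
  by rewrite gt_eqF.
Qed.

Lemma left_cozero (R : realType) a :
  open `]-oo, a]%classic \/ countable_character a ->
  exists u : nat -> K -> R, [/\ forall n, continuous (u n),
    forall n x, (a < x)%O -> u n x = 0 &
    forall x, (x < a)%O -> exists n, u n x != 0].
Proof.
case=> [oa|ca].
  exists (fun _ => \1_(`]-oo, a]%classic)); split.
  - by move=> _; apply: clopen_indicator_continuous => //; exact: lray_closed.
  - by move=> _ x xa; rewrite indicE memNset//= in_itv /= leNgt xa.
  - move=> x ax; exists 0%N; rewrite indicE mem_set ?oner_eq0//=.
    by rewrite in_itv /= ltW.
have [w [cw wa w0]] :=
  countable_character_cozero R compactK (@order_hausdorff d K) ca.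
exists (fun n x => w n (Order.min a x)); split.
- move=> n x; apply: continuous_comp; first exact: continuous_min_line.
  exact: cw.
- by move=> n x /ltW xa; rewrite min_l.
- move=> x ax; rewrite min_r ?ltW//; apply: w0.
  by rewrite lt_eqF.
Qed.

Hypothesis one_sided : forall x, uncountable_character x ->
  isolated_from_one_side x.

(** Connectedness of the class excludes isolation from the inner side, so condition (3) leaves the
    outer one. *)
Lemma line_lo_one_sided x : (line_lo x < line_hi x)%O ->
  open `[line_lo x, +oo[%classic \/ countable_character (line_lo x).
Proof.
move=> lh; have [cx|ncx] := pselect (countable_character (line_lo x)).
  by right.
left; case: (one_sided ncx) => // ox.
by have := line_sim_open_l lh (line_lo_sim_hi compactK x).
Qed.

Lemma line_hi_one_sided x : (line_lo x < line_hi x)%O ->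
  open `]-oo, line_hi x]%classic \/ countable_character (line_hi x).
Proof.
move=> lh; have [cx|ncx] := pselect (countable_character (line_hi x)).
  by right.
left; case: (one_sided ncx) => // ox.
by have := line_sim_open_r lh (line_lo_sim_hi compactK x).
Qed.

(** Products of a left and a right cutoff. A nontrivial class is represented by its lower endpoint
    alone; for every other [a] all functions are zero. *)
Lemma class_cozero (R : realType) a : exists e : nat * nat -> K -> R,
  [/\ forall k, continuous (e k),
      forall k x, e k x != 0 ->
        [/\ a = line_lo a, (line_lo a < line_hi a)%O & line_sim a x] &
      a = line_lo a -> forall x, (line_lo a < x < line_hi a)%O ->
        exists k, e k x != 0].
Proof.
have [[aE lh]|H] := pselect (a = line_lo a /\ (line_lo a < line_hi a)%O); last first.
  exists (fun _ _ => 0); split.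
  - by move=> _ x; exact: cvg_cst.
  - by move=> ? ?; rewrite eqxx.
  - by move=> aE x /andP[ax xb]; exfalso; apply: H; split => //; exact: lt_trans xb.
have [u [cu u0 u1]] := right_cozero R (line_lo_one_sided lh).
have [v [cv v0 v1]] := left_cozero R (line_hi_one_sided lh).
exists (fun k x => u k.1 x * v k.2 x); split.
- by move=> k x; apply: cvgM; [exact: cu|exact: cv].
- move=> k x; rewrite mulf_eq0 negb_or => /andP[ux vx]; split => //.
  apply/line_simP => //; rewrite !leNgt; apply/andP; split; apply/negP => H.
    by rewrite u0 ?eqxx in ux.
  by rewrite v0 ?eqxx in vx.
- move=> _ x /andP[/u1[n un] /v1[m vm]]; exists (n, m).
  by rewrite mulf_eq0 negb_or un.
Qed.

Lemma class_ramp (R : realType) x : exists phi : K -> R,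
  [/\ continuous phi, forall y, 0 <= phi y <= 1 &
      (line_lo x < line_hi x)%O -> phi (line_lo x) = 0 /\ phi (line_hi x) = 1].
Proof.
exists (Urysohn [set line_lo x] [set line_hi x]); split.
- exact: Urysohn_continuous.
- move=> y; have := @Urysohn_range _ R [set line_lo x] [set line_hi x].
  move=> /(_ (Urysohn [set line_lo x] [set line_hi x] y)).
  by rewrite /= in_itv; apply; exists y.
- move=> lh.
  have sep : uniform_separator [set line_lo x] [set line_hi x].
    apply: normal_uniform_separator.
    + by apply: compact_normal => //; exact: order_hausdorff.
    + exact: (compact_closed order_hausdorff (@compact_set1 _ _)).
    + exact: (compact_closed order_hausdorff (@compact_set1 _ _)).
    + by rewrite -subset0 => y [-> E]; rewrite E ltxx in lh.
  split.
    by apply: (Urysohn_sub0 sep (R := R)); exists (line_lo x).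
  by apply: (Urysohn_sub1 sep (R := R)); exists (line_hi x).
Qed.

End interpolation.

(** * Gluing coordinates of K0 and of the classes *)

Section gluing.
Context {d : Order.disp_t} {K : orderTopologicalType d}.
Hypothesis compactK : compact [set: K].
Hypothesis one_sided : forall x : K, uncountable_character x ->
  isolated_from_one_side x.
Context {R : realType}.
Context (Gamma0 : Type) (f : Gamma0 -> K -> R).
Hypothesis sigf : sigma_coordinates (@line_K0 d K) f.
Implicit Types (a x y z : K).

(** An endpoint of countable character is good by density. Any other is isolated from the outer
    side, hence isolated in K0, so density makes it good as well. *)
Lemma K0_endpoint_support z : line_K0 z -> (line_lo z < line_hi z)%O ->
  countable [set gam | f gam z != 0].
Proof.
move=> Kz lh; have [_ _ df] := sigf.
have endpoint y : line_K0 y -> line_sim z y -> y = line_lo z \/ y = line_hi z.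
  move=> /(line_K0P compactK) Ky zy.
  by rewrite (line_lo_eq compactK zy) (line_hi_eq compactK zy).
have [zE|zE] := (line_K0P compactK z).1 Kz.
- have [oz|cz] := line_lo_one_sided compactK one_sided lh; last first.
    by apply: (countable_character_support sigf) => //; rewrite zE.
  have [||y [[/= zy yh] Ky cy]] := df (`[line_lo z, +oo[ `&` `]-oo, line_hi z[)%classic.
  + by apply: openI => //; exact: lray_open.
  + exists z; split => //; split; rewrite /= in_itv /=; first by rewrite line_lo_le.
    by rewrite {1}zE.
  move: zy yh; rewrite !in_itv /= andbT => zy yh.
  have [||yE|yE] := endpoint y => //; first by apply/line_simP; rewrite ?zy ?ltW.
    by rewrite zE -yE.
  by rewrite yE ltxx in yh.
- have [oz|cz] := line_hi_one_sided compactK one_sided lh; last first.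
    by apply: (countable_character_support sigf) => //; rewrite zE.
  have [||y [[/= zy yh] Ky cy]] := df (`]-oo, line_hi z] `&` `]line_lo z, +oo[)%classic.
  + by apply: openI => //; exact: rray_open.
  + exists z; split => //; split; rewrite /= in_itv /=; first by rewrite line_hi_ge.
    by rewrite andbT {2}zE.
  move: zy yh; rewrite !in_itv /= andbT => zy yh.
  have [||yE|yE] := endpoint y => //; first by apply/line_simP; rewrite ?zy ?ltW.
    by rewrite yE ltxx in yh.
  by rewrite zE -yE.
Qed.

Context (phi : K -> K -> R).
Hypothesis phiP : forall x, [/\ continuous (phi x),
  forall y, 0 <= phi x y <= 1 &
  (line_lo x < line_hi x)%O -> phi x (line_lo x) = 0 /\ phi x (line_hi x) = 1].

(** Indexing by [line_lo z] gives all points of a class the same ramp. *)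
Definition interpolate (h : K -> R) z : R :=
  (1 - phi (line_lo z) z) * h (line_lo z) + phi (line_lo z) z * h (line_hi z).

Lemma interpolate_K0 (h : K -> R) z : line_K0 z -> interpolate h z = h z.
Proof.
move=> /(line_K0P compactK) Kz; rewrite /interpolate.
have [lh|lh] := eqVneq (line_lo z) (line_hi z).
  have zE : line_lo z = z by case: Kz => /esym; rewrite -?lh.
  by rewrite -lh zE; ring.
have lh' : (line_lo z < line_hi z)%O.
  by rewrite lt_neqAle lh line_lo_le_hi.
have hE : line_hi (line_lo z) = line_hi z by exact: line_hi_lo.
have [_ _] := phiP (line_lo z); rewrite line_lo_id// hE => /(_ lh')[p0 p1].
case: Kz => zE.
  have -> : phi (line_lo z) z = 0 by rewrite {2}zE.
  by rewrite -zE; ring.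
have -> : phi (line_lo z) z = 1 by rewrite {2}zE.
by rewrite -zE; ring.
Qed.

(** Along the class of [z] the formula is continuous, its endpoint values being fixed. Near a [z] in
    K0, other classes have both endpoint values close to [h z], and hence also their convex
    combinations. *)
Lemma interpolate_continuous (h : K -> R) : {within @line_K0 d K, continuous h} ->
  continuous (interpolate h).
Proof.
move=> /subspace_continuousP ch z; apply/cvgrPdist_lt => e e0.
have same : \forall y \near z, line_sim z y ->
    `|interpolate h z - interpolate h y| < e.
  pose G y := (1 - phi (line_lo z) y) * h (line_lo z)
              + phi (line_lo z) y * h (line_hi z).
  have cG : continuous G.
    have [cphi _ _] := phiP (line_lo z).
    move=> y; apply: cvgD; apply: cvgM; try exact: cvg_cst; last exact: cphi.
    by apply: cvgB; [exact: cvg_cst|exact: cphi].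
  have /cvgrPdist_lt/(_ e e0) := cG z; apply: filterS => y zy sy.
  by rewrite {2}/interpolate -(line_lo_eq compactK sy) -(line_hi_eq compactK sy).
have [Kz|nKz] := pselect (line_K0 z); last first.
  have [lz zh] : z <> line_lo z /\ z <> line_hi z.
    by apply/not_orP => /(line_K0P compactK).
  have nz : \forall y \near z, (line_lo z < y < line_hi z)%O.
    apply: filterS (filterI (nbhs_rray (x := line_lo z) (z := z) _)
      (nbhs_lray (x := line_hi z) (z := z) _)) => [y||].
    - by rewrite /= !in_itv /= andbT => -[-> ->].
    - by rewrite lt_neqAle line_lo_le// andbT eq_sym; apply/eqP.
    - by rewrite lt_neqAle line_hi_ge// andbT; apply/eqP.
  apply: filterS (filterI same nz) => y [sy /andP[ly yh]]; apply: sy.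
  by apply/line_simP; rewrite ?ltW.
have nhz : \forall y \near z, line_K0 y -> `|h z - h y| < e.
  by have /cvgrPdist_lt/(_ e e0) := ch z Kz.
have other := nbhs_classes compactK nhz.
apply: filterS (filterI same other) => y [sy oy].
have [/sy //|nzy] := pselect (line_sim z y).
have lhy : (line_lo y <= line_hi y)%O.
  exact: line_lo_le_hi.
have hl : `|h z - h (line_lo y)| < e.
  by apply: (oy nzy); [rewrite /= in_itv /= lexx|exact: line_K0_lo].
have hh : `|h z - h (line_hi y)| < e.
  by apply: (oy nzy); [rewrite /= in_itv /= lexx lhy|exact: line_K0_hi].
rewrite (interpolate_K0 _ Kz) /interpolate.
have [_ /(_ y)/andP[p0 p1] _] := phiP (line_lo y).
move: hl hh; rewrite !ltr_norml => /andP[l1 l2] /andP[h1 h2].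
move: p0 p1; set t := phi _ _ => p0 p1.
have p1' : 0 <= 1 - t by rewrite subr_ge0.
(* The products of [t] and [1 - t] with the difference of the endpoint values make the goal
   linear. *)
have [hle|/ltW hle] := leP (h (line_lo y)) (h (line_hi y));
  move: hle; rewrite -subr_ge0 => hle;
  have := mulr_ge0 p0 hle; have := mulr_ge0 p1' hle; lra.
Qed.

(** A retraction of [K] onto the class of [a], through which functions continuous on the class
    extend to [K]. *)
Definition clamp a x : K := Order.max (line_lo a) (Order.min (line_hi a) x).

Lemma clamp_class a x : line_class a (clamp a x).
Proof.
apply/line_simP => //; rewrite /clamp le_max lexx /= ge_max ge_min lexx andbT.
exact: line_lo_le_hi.
Qed.

Lemma clamp_id a x : line_sim a x -> clamp a x = x.
Proof.
by move=> /(line_simP compactK)/andP[ax xh]; rewrite /clamp min_r ?max_r.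
Qed.

Lemma clamp_continuous a : continuous (clamp a).
Proof.
move=> x; apply: (@continuous_comp _ _ _ (fun y => Order.min (line_hi a) y)
  (fun y => Order.max (line_lo a) y)).
  exact: continuous_min_line.
exact: continuous_max_line.
Qed.

Lemma within_clamp_continuous a (h : K -> R) :
  {within line_class a, continuous h} -> continuous (h \o clamp a).
Proof.
move=> /subspace_continuousP ch x A nA.
have nh : \forall w \near clamp a x, line_class a w -> A (h w).
  exact: (ch _ (clamp_class a x) A nA).
have := @clamp_continuous a x _ nh; apply: (@filterS _ (nbhs x)) => y Ay.
by apply: Ay; exact: clamp_class.
Qed.

Context (Gamma : K -> Type) (g : forall a, Gamma a -> K -> R).
Hypothesis sigg : forall a, sigma_coordinates (line_class a) (@g a).
Context (e : K -> nat * nat -> K -> R).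
Hypothesis eP : forall a, [/\ forall k, continuous (e a k),
      forall k x, e a k x != 0 ->
        [/\ a = line_lo a, (line_lo a < line_hi a)%O & line_sim a x] &
      a = line_lo a -> forall x, (line_lo a < x < line_hi a)%O ->
        exists k, e a k x != 0].

(** In the second summand, [None] stands for a bare cutoff and [Some gam] for its product with a
    coordinate of the class. *)
Definition glued_index : Type :=
  (Gamma0 + {a : K & ((nat * nat) * option (Gamma a))%type})%type.

Definition glued (i : glued_index) (x : K) : R :=
  match i with
  | inl gam => interpolate (f gam) x
  | inr (existT a (k, None)) => e a k x
  | inr (existT a (k, Some gam)) => e a k x * g gam (clamp a x)
  end.

Lemma glued_continuous i : continuous (glued i).
Proof.
have [cf _ _] := sigf.
case: i => [gam|[a [k [gam|]]]] /=; first exact: interpolate_continuous.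
- have [ce _ _] := eP a; have [cg _ _] := sigg a.
  move=> x; apply: (cvgM (ce k x)).
  exact: (within_clamp_continuous (cg gam)).
- by have [ce _ _] := eP a; exact: ce.
Qed.

(** Off K0 some cutoff of the class is nonzero; the other point then lies in the same class, and
    cancelling the cutoff recovers the class coordinates. On K0 the interpolations are the given
    coordinates. *)
Lemma glued_injective x y : (forall i, glued i x = glued i y) -> x = y.
Proof.
have [_ injf _] := sigf.
have off_K0 u w : (forall i, glued i u = glued i w) -> ~ line_K0 u -> u = w.
  move=> E /(line_K0P compactK)/not_orP[lu uh].
  have [_ e1 e2] := eP (line_lo u).
  have hE : line_hi (line_lo u) = line_hi u by exact: line_hi_lo.
  rewrite line_lo_id// hE in e2.
  have [|k ek] := e2 erefl u.
    rewrite !lt_neqAle line_lo_le// line_hi_ge// !andbT.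
    by apply/andP; split; [rewrite eq_sym|]; exact/eqP.
  have ekw : e (line_lo u) k u = e (line_lo u) k w.
    exact: (E (inr (existT _ (line_lo u) (k, None)))).
  have [_ _ su] := e1 k u ek.
  have [|_ _ sw] := e1 k w; first by rewrite -ekw.
  have [_ injg _] := sigg (line_lo u).
  apply: injg => // gam.
  have := E (inr (existT _ (line_lo u) (k, Some gam))).
  by rewrite /= ekw !clamp_id// => /mulfI; apply; rewrite -ekw.
move=> E; have [Kx|nKx] := pselect (line_K0 x); last exact: off_K0.
have [Ky|nKy] := pselect (line_K0 y); last by apply/esym/off_K0.
apply: injf => // gam; have := E (inl gam).
by rewrite /= !interpolate_K0.
Qed.

(** If [U] meets only trivial classes, it lies in K0 and a good point of K0 serves. Otherwise a
    point good for a nontrivial class is taken strictly inside it: interpolations are controlled by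
    two good endpoints, and cutoffs of other classes vanish. *)
Lemma glued_dense U : open U -> U !=set0 ->
  exists x, U x /\ countable [set i | glued i x != 0].
Proof.
move=> oU [x0 Ux0]; have [_ _ df] := sigf.
have [[y [Uy lh]]|H] := pselect (exists y, U y /\ (line_lo y < line_hi y)%O); last first.
  have triv y : U y -> line_lo y = line_hi y.
    move=> Uy; apply/eqP; rewrite eq_le; apply/andP; split.
      exact: line_lo_le_hi.
    by rewrite leNgt; apply/negP => lh; apply: H; exists y.
  have K0U y : U y -> line_K0 y.
    move=> /triv lh; apply/line_K0P => //; left; apply/eqP.
    by rewrite eq_le line_lo_le// lh line_hi_ge.
  have [||y [Uy Ky cy]] := df U => //; first by exists x0; split => //; exact: K0U.
  exists y; split => //.
  apply: (@sub_countable _ _ _ (inl @` [set gam | f gam y != 0])); last first.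
    exact: sub_countable (card_image_le _ _) cy.
  apply: subset_card_le => -[gam|[a [k o]]] /= iy.
    by exists gam => //; move: iy; rewrite interpolate_K0.
  have [_ e1 _] := eP a.
  have [_ lha say] : [/\ a = line_lo a, (line_lo a < line_hi a)%O & line_sim a y].
    apply: (e1 k); case: o iy => // gam; by rewrite mulf_eq0 negb_or => /andP[].
  move: lha; rewrite (line_lo_eq compactK say) (line_hi_eq compactK say).
  by rewrite triv// ltxx.
have syh : line_sim y (line_hi y) := (line_hiP compactK y).1.
have sly : line_sim (line_lo y) y := line_sim_sym (line_loP compactK y).1.
(* Should [y] be an endpoint, connectedness of its class provides points of [U] strictly inside. *)
have [w [lw wh Uw]] : exists w, [/\ (line_lo y < w)%O, (w < line_hi y)%O & U w].
  have nU : nbhs y U by apply: open_nbhs_nbhs.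
  have [yh|yh] := ltP y (line_hi y).
    have [w [yw nw]] := interior_right (line_sim_open_l yh syh)
      (filterI nU (nbhs_lray yh)).
    have [Uw] := interior_subset nw; rewrite /= in_itv /= => wh.
    by exists w; split => //; exact: le_lt_trans (line_lo_le compactK y) yw.
  have ly : (line_lo y < y)%O by exact: lt_le_trans lh yh.
  have [w [wy nw]] := interior_left (line_sim_open_r ly sly)
    (filterI nU (nbhs_rray ly)).
  have [Uw] := interior_subset nw; rewrite /= in_itv /= andbT => wh.
  by exists w; split => //; exact: lt_le_trans wy (line_hi_ge compactK y).
pose a := line_lo y.
have syw : line_sim y w by apply/line_simP => //; rewrite !ltW.
have saw : line_sim a w by exact: line_sim_trans sly syw.
have [_ _ dg] := sigg a.
have [||z [[Uz]]] := dg (U `&` `]line_lo y, line_hi y[)%classic.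
- by apply: openI => //; exact: itv_open.
- by exists w; split => //; split => //; rewrite /= in_itv /= lw.
rewrite /= in_itv /= => /andP[lz zh] saz cz; exists z; split => //.
have syz : line_sim y z by apply: line_sim_trans (line_sim_sym sly) saz.
have lE := line_lo_eq compactK syz; have hE := line_hi_eq compactK syz.
have lo_lh : (line_lo (line_lo y) < line_hi (line_lo y))%O.
  by rewrite line_lo_id// line_hi_lo.
have hi_lh : (line_lo (line_hi y) < line_hi (line_hi y))%O.
  by rewrite -(line_lo_eq compactK syh) -(line_hi_eq compactK syh).
have cl := K0_endpoint_support (line_K0_lo compactK y) lo_lh.
have ch := K0_endpoint_support (line_K0_hi compactK y) hi_lh.
pose A := [set gam | f gam (line_lo y) != 0] `|` [set gam | f gam (line_hi y) != 0].
pose B : set (nat * nat * option (Gamma a)) :=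
  [set: nat * nat] `*` ([set None] `|` Some @` [set gam | g gam z != 0]).
have countableU T (P Q : set T) : countable P -> countable Q -> countable (P `|` Q).
  move=> cP cQ; rewrite -bigcup2E.
  by apply: bigcup_countable => // -[|[|i]] _ //=; exact: countable0.
have cA : countable A by exact: countableU.
have cB : countable B.
  apply: countableX; first exact: countableP.
  apply: countableU; first exact: countable1.
  exact: sub_countable (card_image_le _ _) cz.
apply: (@sub_countable _ _ _
  ((inl @` A) `|` ((fun b => inr (existT _ a b)) @` B))); last first.
  by apply: countableU; apply: sub_countable (card_image_le _ _) _.
apply: subset_card_le => -[gam|[b [k o]]] iz.
  left; exists gam => //; rewrite /A /=.
  have [fl|fl] := eqVneq (f gam (line_lo y)) 0; last by left.
  right; apply: contra_neq iz => fh.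
  by rewrite /= /interpolate -lE -hE fl fh !mulr0 addr0.
right.
have [bl _ sbz] : [/\ b = line_lo b, (line_lo b < line_hi b)%O & line_sim b z].
  have [_ e1 _] := eP b; apply: (e1 k).
  by case: o iz => //= gam; rewrite mulf_eq0 negb_or => /andP[].
have ab : a = b by rewrite bl (line_lo_eq compactK sbz) -lE.
case: b / ab o iz {bl sbz} => o iz; exists (k, o) => //; split => //=.
case: o iz => [gam|] /=; last by left.
rewrite mulf_eq0 negb_or clamp_id// => /andP[_ gz].
by right; exists gam.
Qed.

End gluing.

(** * Passing between Valdivia compactness of [K] and of its pieces *)

Theorem theorem4p1 (R : realType) (d : Order.disp_t)
    (K : orderTopologicalType d) (compactK : compact [set: K]) :
  valdivia_compact R K <->
  [/\ forall x : K, valdivia_compact R (line_class x),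
      valdivia_compact R (@line_K0 d K) &
      forall x : K, uncountable_character x -> isolated_from_one_side x].
Proof.
have compact_closed_subset (A : set K) : closed A -> compact A.
  by move=> clA; exact: subclosed_compact compactK _.
split=> [/valdivia_setT/valdivia_coordinates[Gamma [f sigf]]|[vclass vK0 one_sided]].
  split.
  - move=> x; have [Gamma' [f' sigf']] := line_class_coordinates sigf x.
    apply: coordinates_valdivia sigf'; apply: compact_closed_subset.
    exact: line_class_closed.
  - have [f' sigf'] := line_K0_coordinates compactK sigf.
    apply: coordinates_valdivia sigf'; apply: compact_closed_subset.
    exact: line_K0_closed.
  - move=> x ux; apply: contrapT => /not_orP[nl nr]; apply: ux.
    exact: (two_sided_countable_character compactK sigf nr nl).
have [Gamma0 [f sigf]] := valdivia_coordinates vK0.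
pose coordP x := cid (valdivia_coordinates (vclass x)).
pose Gamma x := projT1 (coordP x).
pose g x : Gamma x -> K -> R := projT1 (cid (projT2 (coordP x))).
have sigg x : sigma_coordinates (line_class x) (@g x).
  exact: projT2 (cid (projT2 (coordP x))).
pose phi x := projT1 (cid (class_ramp compactK R x)).
have phiP x := projT2 (cid (class_ramp compactK R x)) : _ (phi x).
pose e x := projT1 (cid (class_cozero compactK one_sided R x)).
have eP x := projT2 (cid (class_cozero compactK one_sided R x)) : _ (e x).
apply/valdivia_setT.
apply: (@coordinates_valdivia _ _ _ (glued_index Gamma0 Gamma)
  (glued f phi g e)) => //; split.
- move=> i; apply: continuous_subspaceT.
  exact: (glued_continuous compactK sigf phiP sigg eP).
- by move=> x y _ _; exact: (glued_injective compactK sigf phiP sigg eP).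
- move=> U oU [x [Ux _]].
  have [|y [Uy cy]] := glued_dense compactK one_sided sigf phiP sigg eP oU.
    by exists x.
  by exists y.
Qed.
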